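(* Fix $k\ge3$ and put $q=k-2$. Let $r_{1,n},\ldots,r_{q,n}$ and $m_n$ be positive integers (for each $n$) such that $m_n\le n$ and $$\limsup_{n\to\infty}\frac{r_{1,n}+\cdots+r_{q,n}}{\log_2 n}<2.$$ Then, as $n\to\infty$, $$\Lambda_k(r_{1,n},\ldots,r_{q,n},m_n,n)=(1+o(1))\sqrt n.$$
   Context: $\Lambda_k(d_1,\ldots,d_k)$ denotes the minimum, over all arrays $(\varepsilon_{i_1\cdots i_k})\in\{-1,1\}^{d_1\times\cdots\times d_k}$, of the norm $\sup\{|A(x^{(1)},\ldots,x^{(k)})|:\|x^{(j)}\|_2\le1\}$ of the real $k$-linear form $A(x^{(1)},\ldots,x^{(k)})=\sum\varepsilon_{i_1\cdots i_k}x^{(1)}_{i_1}\cdots x^{(k)}_{i_k}$ on $\mathbb{R}^{d_1}\times\cdots\times\mathbb{R}^{d_k}$ with Euclidean norms. Asymptotic statements involving $\log_2 n$ are understood for integers $n\ge2$. *)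

(* Defs.v *)
From HB Require Import structures.
From mathcomp Require Import all_boot all_order all_algebra.
From mathcomp Require Import all_classical all_reals all_analysis.

Set Implicit Arguments.
Unset Strict Implicit.
Unset Printing Implicit Defensive.

Import Order.TTheory GRing.Theory Num.Theory.
Import numFieldNormedType.Exports.

Local Open Scope classical_set_scope.
Local Open Scope ring_scope.

Definition log2 (R : realType) (x : R) : R := ln x / ln 2.

(* The library norm `|v| on row vectors is the sup norm, hence this one. *)
Definition l2norm (R : realType) (d : nat) (v : 'rV[R]_d) : R :=
  Num.sqrt (\sum_(i < d) v 0 i ^+ 2).

(* Multi-indices (i_1, ..., i_k) of a d_1 x ... x d_k array. *)
Notation multi_index d := {dffun forall j, 'I_(d j)}.

(* An array of signs; the Boolean [b] encodes the sign [(-1) ^+ b]. *)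
Notation sign_array d := {ffun multi_index d -> bool}.

Definition sign_form (R : realType) (k : nat) (d : 'I_k -> nat)
    (e : sign_array d) (x : forall j : 'I_k, 'rV[R]_(d j)) : R :=
  \sum_(i : multi_index d) (-1) ^+ e i * \prod_(j < k) x j 0 (i j).

Definition sign_form_norm (R : realType) (k : nat) (d : 'I_k -> nat)
    (e : sign_array d) : R :=
  sup [set `|sign_form e x| | x in
        [set x : forall j : 'I_k, 'rV[R]_(d j) | forall j, l2norm (x j) <= 1]].

(* The all-ones array [[ffun=> false]] only witnesses that there are finitely
   many, and at least one, arrays to minimize over. *)
Definition Lambda (R : realType) (k : nat) (d : 'I_k -> nat) : R :=
  sign_form_norm R
    [arg min_(e < [ffun=> false] : sign_array d) sign_form_norm R e]%O.

(* The k dimensions (r_1, ..., r_(k-2), m, n), for k >= 2. *)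
Definition dims (k : nat) (r : 'I_k.-2 -> nat) (m n : nat) (j : 'I_k) : nat :=
  nth 0%N ([seq r i | i : 'I_k.-2] ++ [:: m; n]) j.

(* Main.v *)
Require Import Defs.
From mathcomp Require Import all_boot all_order all_algebra.
From mathcomp Require Import all_classical all_reals all_analysis.
From mathcomp Require Import mxtens ring lra zify.

(** The lower bound is elementary: freezing all but the last variable at
    coordinate vectors leaves a linear form on R^n with sign coefficients, whose
    norm is sqrt n ([sqrt_le_Lambda]).

    The upper bound is algebraic. Suppose that there are a Hadamard matrix H of
    order N and symmetric, pairwise anticommuting signed permutation matrices
    U_1, ..., U_r of order N, each of square 1. For a unit vector x the matrix
    U(x) = sum_t x_t U_t satisfies U(x)^2 = 1, hence is an isometry. The matrices
    U_(i_1) ... U_(i_q) H^T have entries 1 and -1, so they form a sign array, and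
    its k-linear form is z^T U(x_1) ... U(x_q) H^T y, of norm at most sqrt N
    because H H^T = N. Restricting the indices gives
    Lambda_k(r_1, ..., r_q, m, n) <= sqrt N whenever r_j <= r and m, n <= N
    ([clifford_sign_array]).

    A real Jordan-Wigner construction provides 2a such matrices U_t in every order
    N = 2^(a+1) M ([clifford_system_exp]). With M = 12^b, the Kronecker products of
    Hadamard matrices of orders 2 and 12 provide H. These orders suffice: since
    log 12 / log 2 is irrational, for every delta > 0 there is a bound B such that
    each large n has some N = 2^(a+1) 12^b with b <= B and
    n <= N <= (1 + delta) n ([dense_sizes]). Boundedness of b makes 2a equal to
    2 log2 n up to a bounded error, so the hypothesis on the limit superior gives
    r_j <= 2a for large n, and the norm is at most sqrt ((1 + delta) n)
    ([Lambda_asymp]). *)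

Import Order.TTheory GRing.Theory Num.Theory.
Import numFieldNormedType.Exports.

Local Open Scope classical_set_scope.
Local Open Scope ring_scope.

(** * Multilinear expansion over dependent multi-indices *)

(** The factors stay in order, so the expansion applies to matrices. *)
Lemma prod_sum_dffun (A : pzSemiRingType) (I : finType) (T : I -> finType)
    (F : forall i, T i -> A) :
  \prod_(i : I) \sum_(t : T i) F i t
  = \sum_(f : {dffun forall i, T i}) \prod_(i : I) F i (f i).
Proof.
pose P i : {ffun T i -> A} := [ffun t => F i t].
transitivity (\prod_(i : I) \sum_(u in tagged_with T i) untag 0 (P i) u).
  apply: eq_bigr => i _; rewrite -(big_tag (fun i t => P i t)).
  by apply: eq_bigr => t _; rewrite ffunE.
rewrite bigA_distr_big_dep -big_fprod.
rewrite (reindex (@fprod_of_dffun I T)); last exact/onW_bij/fprod_of_dffun_bij.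
apply: eq_bigr => f _; apply: eq_bigr => i _.
by rewrite ffunE fprodE.
Qed.

(** * Hadamard matrices *)

(** Squaring to 1 says that an entry is a sign, in a form that passes through
    products and negation. *)
Definition sign_mx {R : realType} {m n} (M : 'M[R]_(m, n)) :=
  forall i j, M i j ^+ 2 = 1.

Definition hadamard (R : realType) n :=
  exists2 H : 'M[R]_n, sign_mx H & H *m H^T = n%:R%:M.

(** The Kronecker product of two Hadamard matrices. *)
Lemma hadamard_mul (R : realType) m n :
  hadamard R m -> hadamard R n -> hadamard R (m * n)%N.
Proof.
move=> [H Hs HH] [K Ks KK]; exists (tensmx H K).
  by move=> i j; rewrite mxE exprMn Hs Ks mulr1.
rewrite trmx_tens tensmx_mul HH KK; apply/matrixP => i j.
case: (mxtens_indexP i) => i1 i2; case: (mxtens_indexP j) => j1 j2.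
rewrite tensmxE !mxE (can_eq (@mxtens_indexK m n)) xpair_eqE.
by case: (i1 == j1); case: (i2 == j2); rewrite ?mulr0n ?mulr0 ?mul0r // !mulr1n natrM.
Qed.

Lemma hadamard1 (R : realType) : hadamard R 1.
Proof.
exists 1%:M; first by move=> i j; rewrite !ord1 mxE eqxx expr1n.
by rewrite trmx1 mulmx1.
Qed.

Lemma hadamard_exp (R : realType) n e : hadamard R n -> hadamard R (n ^ e)%N.
Proof.
move=> Hn; elim: e => [|e IH]; first exact: hadamard1.
by rewrite expnS; apply: hadamard_mul.
Qed.

Lemma sum_signs (R : realType) n (b : nat -> bool) :
  \sum_(k < n) (-1) ^+ b k = n%:R - (2 * count b (iota 0 n))%:R :> R.
Proof.
rewrite -(big_mkord xpredT (fun k => (-1) ^+ b k)) /index_iota subn0.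
rewrite -[n in n%:R](size_iota 0); elim: (iota 0 n) => [|x s IH].
  by rewrite big_nil subr0.
by rewrite big_cons IH /=; case: (b x); rewrite /= ?expr1 ?expr0; lra.
Qed.

(** Two rows of signs are orthogonal when they differ in half of the places;
    counting the differences of Boolean rows makes this a computation. *)
Lemma hadamard_of_bool (R : realType) n (h : nat -> nat -> bool) :
  all (fun i => all (fun j =>
      n == (if i == j then n else 0)
           + 2 * count (fun k => h i k (+) h j k) (iota 0 n))%N
    (iota 0 n)) (iota 0 n) -> hadamard R n.
Proof.
move=> /allP hP; exists (\matrix_(i, j) (-1) ^+ h i j).
  by move=> i j; rewrite mxE -exprM mulnC exprM sqrrN expr1n expr1n.
apply/matrixP => i j; rewrite !mxE.
under eq_bigr do rewrite !mxE -signr_addb.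
rewrite (sum_signs R n (fun k => h i k (+) h j k)).
have/hP/allP/(_ (val j)) : val i \in iota 0 n by rewrite mem_iota ltn_ord.
rewrite mem_iota ltn_ord => /(_ isT)/eqP {1}->.
by rewrite natrD addrK val_eqE; case: eqP.
Qed.

Lemma hadamard2 R : hadamard R 2.
Proof.
by apply: (@hadamard_of_bool R 2 (fun i j => (i != 0) && (j != 0)))%N; vm_compute.
Qed.

(** Paley's construction for the quadratic residues 1, 3, 4, 5, 9 modulo 11,
    bordered by the index 0. *)
Definition paley12 (i j : nat) : bool :=
  [&& i != 0, i != j
    & (j == 0) || (((i + 11 - j) %% 11) \notin [:: 1; 3; 4; 5; 9])]%N.

Lemma hadamard12 R : hadamard R 12.
Proof. by apply: (@hadamard_of_bool R 12 paley12); vm_compute. Qed.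

(** * Anticommuting signed permutation matrices *)

(** Signed permutation matrices are used only through this closure property,
    which is stable under products and block constructions. *)
Definition sign_preserving {R : realType} {n} (U : 'M[R]_n) :=
  forall p (M : 'M[R]_(n, p)), sign_mx M -> sign_mx (U *m M).

(** The commuting complex structure [J] is what lets the family grow by two at
    each doubling of the order: it makes [[0, J], [-J, 0]] symmetric, although
    [[0, 1], [-1, 0]] is not. *)
Definition clifford_system (R : realType) (r n : nat) :=
  exists (U : nat -> 'M[R]_n) (J : 'M[R]_n),
  [/\ forall t, (t < r)%N -> sign_preserving (U t) /\ (U t)^T = U t,
      forall s t, (s < r)%N -> (t < r)%N ->
        U s *m U t + U t *m U s = (2 * (s == t))%:R%:M,
      sign_preserving J,
      J^T = - J /\ J *m J = - 1%:M
    & forall t, (t < r)%N -> J *m U t = U t *m J].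

Lemma sign_mxN (R : realType) m n (M : 'M[R]_(m, n)) : sign_mx M -> sign_mx (- M).
Proof. by move=> sM i j; rewrite mxE sqrrN. Qed.

Lemma sign_col_mx (R : realType) m1 m2 n (M1 : 'M[R]_(m1, n)) (M2 : 'M[R]_(m2, n)) :
  sign_mx (col_mx M1 M2) <-> sign_mx M1 /\ sign_mx M2.
Proof.
split=> [sM | [s1 s2] i j]; last first.
  by rewrite mxE; case: fintype.split => k.
by split=> i j; [have := sM (lshift m2 i) j | have := sM (rshift m1 i) j];
  rewrite (col_mxEu, col_mxEd).
Qed.

Lemma sign_preserving_diag (R : realType) m n (A : 'M[R]_m) (B : 'M[R]_n) :
  sign_preserving A -> sign_preserving B ->
  sign_preserving (block_mx A 0 0 B).
Proof.
move=> sA sB p M; rewrite -[M]vsubmxK mul_block_col !mul0mx addr0 add0r.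
by move=> /sign_col_mx[s1 s2]; apply/sign_col_mx; split; [apply: sA | apply: sB].
Qed.

Lemma sign_preserving_antidiag (R : realType) n (A B : 'M[R]_n) :
  sign_preserving A -> sign_preserving B ->
  sign_preserving (block_mx 0 A B 0).
Proof.
move=> sA sB p M; rewrite -[M]vsubmxK mul_block_col !mul0mx addr0 add0r.
by move=> /sign_col_mx[s1 s2]; apply/sign_col_mx; split; [apply: sA | apply: sB].
Qed.

Lemma sign_preservingN (R : realType) n (A : 'M[R]_n) :
  sign_preserving A -> sign_preserving (- A).
Proof. by move=> sA p M sM; rewrite mulNmx; apply/sign_mxN/sA. Qed.

Lemma sign_preserving1 (R : realType) n : sign_preserving (1%:M : 'M[R]_n).
Proof. by move=> p M; rewrite mul1mx. Qed.

Lemma clifford_system0 (R : realType) n : clifford_system R 0 (n + n).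
Proof.
exists (fun=> 0), (block_mx 0 1%:M (- 1%:M) 0); split=> //.
- by apply: sign_preserving_antidiag; [|apply: sign_preservingN];
    apply: sign_preserving1.
- split; first by rewrite tr_block_mx opp_block_mx linearN /= !trmx0 trmx1 !oppr0 opprK.
  rewrite mulmx_block !mul0mx !mulmx0 mul1mx mulmx1 !addr0 !add0r.
  by rewrite scalar_mx_block opp_block_mx !oppr0.
Qed.

(** The real form of the Jordan-Wigner construction: in terms of Pauli matrices
    the new family consists of X (x) 1, Y (x) J and Z (x) U_t, and the new complex
    structure is 1 (x) J. *)
Lemma clifford_systemSS (R : realType) r n :
  clifford_system R r n -> clifford_system R r.+2 (n + n).
Proof.
move=> [U [J [sU UU sJ [JT JJ] JU]]].
pose V t := match t with
  | 0 => block_mx 0 1%:M 1%:M 0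
  | 1 => block_mx 0 J (- J) 0
  | t.+2 => block_mx (U t) 0 0 (- U t)
  end.
exists V, (block_mx J 0 0 J); split.
- move=> [|[|t]] /=.
  + split; last by rewrite tr_block_mx !trmx0 trmx1.
    by apply: sign_preserving_antidiag; apply: sign_preserving1.
  + split; last by rewrite tr_block_mx !trmx0 linearN /= JT opprK.
    by apply: sign_preserving_antidiag; last apply: sign_preservingN.
  + rewrite !ltnS => /sU[sUt UtT]; split.
      by apply: sign_preserving_diag; last apply: sign_preservingN.
    by rewrite tr_block_mx !trmx0 linearN /= UtT.
- move=> [|[|s]] [|[|t]] /=; rewrite ?ltnS => hs ht;
    rewrite ?mulmx_block ?mul0mx ?mulmx0 ?mul1mx ?mulmx1 ?addr0 ?add0r ?add_block_mx;
    rewrite ?mulmxN ?mulNmx ?opprK ?JJ ?JU ?opprK ?oppr0 ?addr0 ?subrr ?addNr ?UU //;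
    rewrite ?muln0 ?muln1 scalar_mx_block ?raddf0 //.
  + by rewrite -raddfD.
  + by rewrite -raddfD.
- exact: sign_preserving_diag.
- split; first by rewrite tr_block_mx !trmx0 JT opp_block_mx !oppr0.
  rewrite mulmx_block !mulmx0 !mul0mx !addr0 !add0r JJ.
  by rewrite scalar_mx_block opp_block_mx !oppr0.
- move=> [|[|t]] /=; rewrite ?ltnS => ht;
    rewrite ?mulmx_block ?mul0mx ?mulmx0 ?mul1mx ?mulmx1 ?addr0 ?add0r //.
  + by rewrite mulmxN mulNmx.
  + by rewrite mulmxN mulNmx JU.
Qed.

(** About twice the binary logarithm of the order: the source of the constant 2
    in the growth condition. *)
Lemma clifford_system_exp (R : realType) p n :
  clifford_system R (2 * p) (2 ^ p.+1 * n).
Proof.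
elim: p => [|p IH]; first by rewrite muln0 mul2n -addnn; apply: clifford_system0.
rewrite mulnS expnS -mulnA (mul2n (2 ^ _ * _)) -addnn.
exact: clifford_systemSS.
Qed.

(** Anticommutation cancels the cross terms, so that a unit vector of
    coefficients gives a symmetric involution, hence an isometry. *)
Lemma clifford_sum_sqr (R : realType) r n (U : nat -> 'M[R]_n) d (x : 'rV[R]_d) :
  (forall s t, (s < r)%N -> (t < r)%N ->
     U s *m U t + U t *m U s = (2 * (s == t))%:R%:M) -> (d <= r)%N ->
  (\sum_(t < d) x 0 t *: U t) *m (\sum_(t < d) x 0 t *: U t)
  = (\sum_(t < d) x 0 t ^+ 2)%:M.
Proof.
move=> UU dr; set S := (LHS).
have SE : S = \sum_(s < d) \sum_(t < d) (x 0 s * x 0 t) *: (U s *m U t).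
  rewrite /S mulmx_suml; apply: eq_bigr => s _; rewrite mulmx_sumr.
  by apply: eq_bigr => t _; rewrite -scalemxAl -scalemxAr scalerA.
have: S + S = 2%:R *: (\sum_(t < d) x 0 t ^+ 2)%:M.
  rewrite {2}SE exchange_big SE -big_split /= raddf_sum scaler_sumr.
  apply: eq_bigr => s _; rewrite -big_split /= (bigD1 s) //= big1 ?addr0.
    by rewrite -scalerDr UU ?(leq_trans (ltn_ord s)) // eqxx !scale_scalar_mx
      muln1 mulrC expr2.
  move=> t ts; rewrite mulrC -scalerDr UU ?(leq_trans (ltn_ord _)) //.
  by rewrite val_eqE 1?eq_sym (negbTE ts) muln0 raddf0 scaler0.
rewrite -mulr2n -scaler_nat => /(scalerI _); apply.
by rewrite pnatr_eq0.
Qed.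

(** * A sign array of small norm *)

(** Cauchy-Schwarz, from the expansion of the squares of s u - w with
    s = sqrt c and s = - sqrt c. *)
Lemma dot_le_sqrt (R : realType) (I : finType) (u w : I -> R) (c : R) :
  0 < c -> \sum_i u i ^+ 2 <= 1 -> \sum_i w i ^+ 2 <= c ->
  `|\sum_i u i * w i| <= Num.sqrt c.
Proof.
move=> c0 u1 wc; have s0 : 0 < Num.sqrt c by rewrite sqrtr_gt0.
have key (s : R) : s ^+ 2 = c -> 2 * s * (\sum_i u i * w i) <= 2 * c.
  move=> sc; have : 0 <= \sum_i (s * u i - w i) ^+ 2.
    by apply: sumr_ge0 => i _; apply: sqr_ge0.
  have -> : \sum_i (s * u i - w i) ^+ 2
      = s ^+ 2 * \sum_i u i ^+ 2 - 2 * s * (\sum_i u i * w i) + \sum_i w i ^+ 2.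
    rewrite !mulr_sumr -sumrN -!big_split /=; apply: eq_bigr => i _; ring.
  have : s ^+ 2 * \sum_i u i ^+ 2 <= c by rewrite sc ler_piMr // ltW.
  lra.
have sc := sqr_sqrtr (ltW c0).
rewrite ler_norml; apply/andP; split.
  have := key (- Num.sqrt c); rewrite sqrrN => /(_ sc); nra.
have := key (Num.sqrt c) sc; nra.
Qed.

Lemma tr_mul_prod (R : realType) n (I : Type) (s : seq I) (F : I -> 'M[R]_n.+1)
    (c : I -> R) :
  (forall i, (F i)^T *m F i = (c i)%:M) ->
  (\prod_(i <- s) F i)^T *m (\prod_(i <- s) F i) = (\prod_(i <- s) c i)%:M.
Proof.
move=> FF; elim/big_rec2: _ => [|i c' P _ PP]; first by rewrite trmx1 mulmx1.
rewrite -mulmxE trmx_mul -mulmxA [(F i)^T *m _]mulmxA FF.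
by rewrite mul_scalar_mx -scalemxAr PP scale_scalar_mx.
Qed.

Lemma sign_preserving_prod (R : realType) n (I : Type) (s : seq I)
    (F : I -> 'M[R]_n.+1) :
  (forall i, sign_preserving (F i)) -> sign_preserving (\prod_(i <- s) F i).
Proof.
move=> sF; elim/big_ind: _ => //; first exact: sign_preserving1.
by move=> A B sA sB p M sM; rewrite -mulmxE -mulmxA; apply/sA/sB.
Qed.

Lemma sum_scale_delta (R : realType) n d (y : 'rV[R]_d) : (d <= n.+1)%N ->
  \sum_(t < d) y 0 t *: delta_mx 0 (inord t) = y *m pid_mx d :> 'rV_n.+1.
Proof.
move=> dn; apply/rowP => s; rewrite summxE !mxE; apply: eq_bigr => t _.
rewrite !mxE /= ltn_ord andbT -val_eqE /= inordK ?(leq_trans _ dn) //.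
by rewrite eq_sym.
Qed.

Lemma mulmx_tr_pid (R : realType) n d (y : 'rV[R]_d) : (d <= n)%N ->
  (y *m pid_mx d) *m (y *m (pid_mx d : 'M[R]_(d, n)))^T = (\sum_(t < d) y 0 t ^+ 2)%:M.
Proof.
move=> dn; rewrite trmx_mul mulmxA tr_pid_mx -(mulmxA y) mul_pid_mx minnn.
rewrite (minn_idPr dn) pid_mx_1 mulmx1; apply/rowP => i; rewrite !ord1 !mxE /=.
by rewrite mulr1n; apply: eq_bigr => t _; rewrite !mxE expr2.
Qed.

(** The matrix that the index [t] contributes in slot [j]. The trace of the
    product of one matrix per slot is
    U_(i_1) ... U_(i_q) H^T e_a (e_0^T e_0) e_b^T, that is, the (b, a) entry of
    U_(i_1) ... U_(i_q) H^T, where a and b are the last two indices; the trace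
    turns the whole form into one ordered product of matrices. *)
Definition slot_mx {R : realType} {n} q (U : nat -> 'M[R]_n.+1) (H : 'M[R]_n.+1)
    (j t : nat) : 'M[R]_n.+1 :=
  if (j < q)%N then U t
  else if j == q then H^T *m (delta_mx (inord t) 0 : 'cV_n.+1) *m (delta_mx 0 0 : 'rV_n.+1)
  else (delta_mx 0 0 : 'cV_n.+1) *m (delta_mx 0 (inord t) : 'rV_n.+1).

Lemma sum_sqr_le1 (R : realType) d (v : 'rV[R]_d) :
  l2norm v <= 1 -> \sum_(t < d) v 0 t ^+ 2 <= 1.
Proof.
move=> v1; rewrite -[leLHS]sqr_sqrtr; last by apply: sumr_ge0 => t _; apply: sqr_ge0.
by rewrite exprn_ile1 // sqrtr_ge0.
Qed.

(** The matrices U_(i_1) ... U_(i_q) H^T have sign entries, since the U_t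
    preserve signs. Summed against vectors of the unit ball they become
    U(x_1) ... U(x_q) H^T, where each U(x_j) has norm at most 1 and H^T is
    sqrt N times an isometry. *)
Lemma clifford_sign_array (R : realType) r n q (d : 'I_q.+2 -> nat) :
  hadamard R n.+1 -> clifford_system R r n.+1 ->
  (forall j : 'I_q.+2, (j < q)%N -> (d j <= r)%N) ->
  (forall j : 'I_q.+2, (q <= j)%N -> (d j <= n.+1)%N) ->
  exists e : sign_array d, forall x : forall j, 'rV[R]_(d j),
    (forall j, l2norm (x j) <= 1) -> `|sign_form e x| <= Num.sqrt (n.+1%:R).
Proof.
move=> [H sH HH] [U [J [sU UU _ _ _]]] dr dn.
pose G := slot_mx q U H.
have sT (i : multi_index d) : (\tr (\prod_(j < q.+2) G j (i j))) ^+ 2 = 1.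
  rewrite 2!big_ord_recr /= {2 3}/G /slot_mx !ltnn ltnNge leqnSn eqxx /= gtn_eqF //.
  set P := \prod_(j < q) _.
  have sP : sign_preserving P.
    apply: sign_preserving_prod => j; rewrite /G /slot_mx /= ltn_ord.
    by apply: (proj1 (sU _ _)); apply: leq_trans (dr _ _); rewrite //=.
  set a := inord (i _); set b := inord (i _).
  rewrite -!mulmxE.
  have -> : P *m (H^T *m (delta_mx a 0 : 'cV_n.+1) *m (delta_mx 0 0 : 'rV_n.+1))
        *m ((delta_mx 0 0 : 'cV_n.+1) *m (delta_mx 0 b : 'rV_n.+1))
      = (P *m H^T) *m delta_mx a b.
    by rewrite -!mulmxA !mul_delta_mx.
  have -> : \tr ((P *m H^T) *m delta_mx a b) = (P *m H^T) b a.
    rewrite /mxtrace (bigD1 b) //= big1 ?addr0.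
      rewrite mxE (bigD1 a) //= [X in _ * X + _]mxE !eqxx mulr1 big1 ?addr0 // => j ja.
      by rewrite [X in _ * X]mxE (negbTE ja) mulr0.
    move=> j jb; rewrite mxE big1 // => l _; rewrite [X in _ * X]mxE (negbTE jb) andbF mulr0 //.
  by apply: sP => s t; rewrite mxE.
(* [true] encodes -1, so the sign of a trace equal to 1 or -1 is [\tr _ < 0]. *)
exists [ffun i : multi_index d => \tr (\prod_(j < q.+2) G j (i j)) < 0] => x x1.
pose low (j : 'I_q) : 'I_q.+2 :=
  widen_ord (leqnSn q.+1) (widen_ord (leqnSn q) j).
pose S (j : 'I_q.+2) := \sum_(t < d j) x j 0 t *: G j t.
have -> : sign_form [ffun i : multi_index d => \tr (\prod_(j < q.+2) G j (i j)) < 0] x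
    = \tr (\prod_(j < q.+2) S j).
  rewrite prod_sum_dffun raddf_sum; apply: eq_bigr => i _.
  rewrite /= scaler_prod mxtraceZ mulrC ffunE; congr (_ * _).
  have /eqP := sT i; rewrite sqrf_eq1 => /orP[] /eqP ->.
    by rewrite ltr10.
  by rewrite ltrN10 expr1.
rewrite 2!big_ord_recr /= -!mulmxE.
set P := \prod_(j < q) _.
set jm := widen_ord _ _; set jn := (ord_max : 'I_q.+2).
have Sm : S jm = H^T *m (x jm *m pid_mx (d jm))^T *m (delta_mx 0 0 : 'rV_n.+1).
  rewrite -sum_scale_delta ?dn //=.
  rewrite /S linear_sum mulmx_sumr mulmx_suml; apply: eq_bigr => t _.
  rewrite /G /slot_mx /= ltnn eqxx linearZ /= -!scalemxAr -!scalemxAl.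
  by rewrite trmx_delta.
have Sn : S jn = (delta_mx 0 0 : 'cV_n.+1) *m (x jn *m pid_mx (d jn)).
  rewrite -sum_scale_delta ?dn //=.
  rewrite /S mulmx_sumr; apply: eq_bigr => t _.
  by rewrite /G /slot_mx /= ltnNge leqnSn /= gtn_eqF // -!scalemxAr.
pose c (j : 'I_q) := \sum_t x (low j) 0 t ^+ 2.
have PP : P^T *m P = (\prod_(j < q) c j)%:M.
  apply: tr_mul_prod => j.
  have SU : S (low j) = \sum_(t < d (low j)) x (low j) 0 t *: U t.
    by apply: eq_bigr => t _; rewrite /G /slot_mx /= ltn_ord.
  rewrite -/(low j) SU -(@clifford_sum_sqr R r n.+1 U) ?dr //=.
  congr (_ *m _); rewrite linear_sum; apply: eq_bigr => t _.
  rewrite linearZ /= (proj2 (sU t _)) //.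
  by apply: leq_trans (dr _ _); rewrite //=.
have [u uE] : exists u, u = x jn *m pid_mx (d jn) :> 'rV_n.+1 by eexists.
rewrite -uE in Sn.
have [v vE] : exists v, v = x jm *m pid_mx (d jm) :> 'rV_n.+1 by eexists.
rewrite -vE in Sm.
set w := P *m H^T *m v^T.
have -> : \tr (P *m S jm *m S jn) = \sum_s u 0 s * w s 0.
  rewrite Sm Sn !mulmxA -/w -(mulmxA w) mul_delta_mx.
  rewrite mxtrace_mulC trace_mx11 [delta_mx 0 0 in LHS](_ : _ = 1%:M); last first.
    by apply/matrixP => i j; rewrite !ord1 !mxE.
  by rewrite mulmx1 mxE.
apply: dot_le_sqrt; first by rewrite ltr0n.
  have /matrixP/(_ 0 0) := @mulmx_tr_pid R n.+1 _ (x jn) (dn jn (leqnSn q)).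
  rewrite -uE !mxE mulr1n => uu.
  apply: le_trans (sum_sqr_le1 _ _ _ (x1 jn)); rewrite -uu.
  by apply: ler_sum => s _; rewrite [u^T _ _]mxE expr2.
have vv := @mulmx_tr_pid R n.+1 _ (x jm) (dn jm (leqnn q)); rewrite -vE in vv.
have ww : w^T *m w = ((\prod_(j < q) c j) * n.+1%:R * \sum_t x jm 0 t ^+ 2)%:M.
  rewrite /w !trmx_mul !trmxK -!mulmxA (mulmxA P^T) PP mul_scalar_mx.
  rewrite -!scalemxAr (mulmxA H) HH mul_scalar_mx -scalemxAr vv.
  by rewrite !scale_scalar_mx mulrA.
have /matrixP/(_ 0 0) := ww; rewrite !mxE mulr1n => wwE.
have -> : \sum_s w s 0 ^+ 2 = \sum_s w^T 0 s * w s 0.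
  by apply: eq_bigr => s _; rewrite [w^T _ _]mxE expr2.
rewrite wwE -mulrA mulrCA ler_piMr ?ler0n //.
have c01 (j : 'I_q) : 0 <= c j <= 1.
  by rewrite sum_sqr_le1 // andbT; apply: sumr_ge0 => t _; apply: sqr_ge0.
apply: mulr_ile1; last exact: sum_sqr_le1.
- by apply: prodr_ge0 => j _; case/andP: (c01 j).
- by apply: sumr_ge0 => t _; apply: sqr_ge0.
- by apply: prodr_ile1.
Qed.

(** * Elementary bounds on the minimal norm *)

Lemma sign_form_norm_le (R : realType) k (d : 'I_k -> nat) (e : sign_array d) (C : R) :
  (forall x : forall j, 'rV[R]_(d j), (forall j, l2norm (x j) <= 1) ->
     `|sign_form e x| <= C) -> sign_form_norm R e <= C.
Proof.
move=> hC; apply: ge_sup; last by move=> _ [x /= x1 <-]; apply: hC.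
exists `|sign_form e (fun j => (0 : 'rV[R]_(d j)))|, (fun=> 0) => //= j.
by rewrite /l2norm big1 ?sqrtr0 // => i _; rewrite mxE expr0n.
Qed.

Lemma le_sign_form_norm (R : realType) k (d : 'I_k -> nat) (e : sign_array d)
    (x : forall j, 'rV[R]_(d j)) :
  (forall j, l2norm (x j) <= 1) -> `|sign_form e x| <= sign_form_norm R e.
Proof.
move=> x1; apply: ub_le_sup; last by exists x.
exists (\sum_(i : multi_index d) 1) => _ [y /= y1 <-].
apply: le_trans (ler_norm_sum _ _ _) _; apply: ler_sum => i _.
rewrite normrM normrX normrN1 expr1n mul1r normr_prod.
apply: prodr_ile1 => j _; rewrite normr_ge0 /= -[leRHS]sqrtr1 -sqrtr_sqr ler_sqrt //.
apply: le_trans (sum_sqr_le1 _ _ _ (y1 j)); rewrite (bigD1 (i j)) //= lerDl.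
by apply: sumr_ge0 => t _; apply: sqr_ge0.
Qed.

Lemma Lambda_le (R : realType) k (d : 'I_k -> nat) (e : sign_array d) :
  Lambda R d <= sign_form_norm R e.
Proof. by rewrite /Lambda; case: arg_minP => // e' _; apply. Qed.

(** Coordinate vectors in every slot but [l] leave a linear form on R^(d l) with
    sign coefficients, whose Euclidean norm is the square root of d l. *)
Lemma sqrt_le_Lambda (R : realType) k (d : 'I_k -> nat) (l : 'I_k) :
  (forall j, (0 < d j)%N) -> Num.sqrt (d l)%:R <= Lambda R d.
Proof.
move=> d0; rewrite /Lambda; set e := [arg min_(_ < _) _]%O.
pose c j : 'I_(d j) := Ordinal (d0 j).
pose upd (j : 'I_k) (t : 'I_(d j)) : multi_index d := [ffun i => @eqtype.dfwith _ (fun i => 'I_(d i)) c j t i].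
have dl0 : 0 < (d l)%:R :> R by rewrite ltr0n.
pose x j : 'rV[R]_(d j) := \row_t
  if j == l then (-1) ^+ e (upd j t) / Num.sqrt (d l)%:R else (t == c j)%:R.
suff <- : `|sign_form e x| = Num.sqrt (d l)%:R.
  apply: le_sign_form_norm => j; rewrite /l2norm -[leRHS]sqrtr1 ler_sqrt //.
  under eq_bigr do rewrite mxE.
  have [->|jl] := eqVneq j l.
    under eq_bigr do rewrite exprMn -exprM mulnC exprM sqrrN expr1n expr1n mul1r.
    rewrite sumr_const card_ord -[leLHS]mulr_natl exprVn sqr_sqrtr ?ler0n //.
    by rewrite divff // gt_eqF.
  rewrite (bigD1 (c j)) //= ?eqxx expr1n big1 ?addr0 // => t /negbTE ->.
  by rewrite expr0n.
have -> : sign_form e x = \sum_(t < d l) (Num.sqrt (d l)%:R)^-1.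
  rewrite /sign_form (bigID (fun i : multi_index d => i == upd l (i l))) /=.
  (* A multi-index that leaves the base point [c] outside slot [l] has a zero factor. *)
  rewrite [X in _ + X]big1 ?addr0; last first.
    move=> i iu; suff [j /andP[jl ijc]] : exists j, (j != l) && (i j != c j).
      by rewrite (bigD1 j) //= mxE (negbTE jl) (negbTE ijc) mul0r mulr0.
    apply/existsP; apply: contraR iu => /existsPn h; apply/eqP/ffunP => j.
    rewrite ffunE; case: eqtype.dfwithP => // j' lj'.
    by have := h j'; rewrite eq_sym lj' /= negbK => /eqP.
  rewrite (reindex_onto (upd l) (fun i => i l)) /=; last by move=> i /eqP.
  have ul (t : 'I_(d l)) : upd l t l = t by rewrite ffunE eqtype.dfwith_in.
  apply: eq_big => [t|t _]; first by rewrite ul !eqxx.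
  rewrite (bigD1 l) //= mxE eqxx ul big1 ?mulr1.
    by rewrite mulrA -signr_addb addbb mul1r.
  by move=> j jl; rewrite mxE (negbTE jl) ffunE eqtype.dfwith_out 1?eq_sym // eqxx.
rewrite sumr_const card_ord -[X in `|X|]mulr_natl ger0_norm; last first.
  by rewrite divr_ge0 ?ler0n ?sqrtr_ge0.
by rewrite -{1}[(d l)%:R]sqr_sqrtr ?ler0n // expr2 mulfK // gt_eqF // sqrtr_gt0.
Qed.

(** * Density of the available orders *)

(** The multiple of [x] nearest to plus or minus [y] misses it by at most half
    of [x]; iterated, this gives arbitrarily small combinations. *)
Lemma halving (R : realType) (x y : R) : 0 < `|x| <= y ->
  exists (j : nat) (s : int), (0 < j)%N /\ `|j%:R * x - s%:~R * y| <= `|x| / 2.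
Proof.
move=> /andP[x0 xy].
pose t := y / `|x|; have tE : y = t * `|x| by rewrite divfK // gt_eqF.
have t1 : 1 <= t by rewrite ler_pdivlMr ?mul1r.
have /andP[j1 j2] : (Num.truncn (t + 2^-1))%:R <= t + 2^-1 < (Num.truncn (t + 2^-1)).+1%:R.
  by apply: truncn_itv; lra.
exists (Num.truncn (t + 2^-1)), (sgz x).
set j := Num.truncn _ in j1 j2 *.
have {}j2 : t + 2^-1 < j%:R + 1 by rewrite natr1.
split; first by rewrite lt0n; apply/eqP => j0; rewrite j0 in j2; lra.
have -> : (sgz x)%:~R * y = t * x.
  by rewrite -sgrEz tE mulrCA -numEsg.
rewrite -mulrBl normrM mulrC ler_wpM2l //; rewrite ler_norml; lra.
Qed.

Lemma pow12_neq_pow2 (i j : nat) : (0 < j)%N -> (12 ^ j)%N != (2 ^ i)%N.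
Proof.
case: j => // j _; apply/eqP => E.
have : (3 %| 2 ^ i)%N by rewrite -E expnS dvdn_mulr.
by rewrite Euclid_dvdX.
Qed.

(** No power of 12 is a power of 2, as 3 divides only the former. *)
Lemma ln_combo_neq0 (R : realType) (j : nat) (i : int) : (0 < j)%N ->
  j%:R * ln 12 - i%:~R * ln 2 != 0 :> R.
Proof.
move=> j0; have ln2 : 0 < ln 2 :> R by rewrite ln_gt0 // ltr1n.
have ln12 : 0 < ln 12 :> R by rewrite ln_gt0 // ltr1n.
rewrite subr_eq0; apply/eqP => E.
have : 0 < i%:~R * ln 2 :> R by rewrite -E mulr_gt0 // ltr0n.
rewrite pmulr_lgt0 // ltr0z; case: i E => // i E _.
have := pow12_neq_pow2 i _ j0; rewrite -(eqr_nat R) => /eqP; apply.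
rewrite !natrX; apply: ln_inj; rewrite ?posrE ?exprn_gt0 // !lnXn //.
by rewrite -[LHS]mulr_natl E mulr_natl.
Qed.

(** [ln 2] and [ln 12] are incommensurable, so their integer combinations come
    arbitrarily close to 0; the descent starts from ln (12 / 8). *)
Lemma small_ln_combo (R : realType) (s : nat) :
  exists (j : nat) (i : int), (0 < j)%N /\
    `|j%:R * ln 12 - i%:~R * ln 2| <= ln 2 / 2 ^+ s :> R.
Proof.
have ln2 : 0 < ln 2 :> R by rewrite ln_gt0 // ltr1n.
elim: s => [|s [j [i [j0 IH]]]].
  exists 1%N, 3%:Z; split=> //; rewrite mul1r expr0 divr1.
  have -> : ln 12 = 2 * ln 2 + ln 3 :> R.
    by rewrite mulr_natl -lnXn // -lnM ?posrE //; congr ln; lra.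
  have : ln 2 <= ln 3 :> R by rewrite ler_ln ?posrE //; lra.
  have : ln 3 <= 2 * ln 2 :> R by rewrite mulr_natl -lnXn // ler_ln ?posrE //; lra.
  rewrite ler_norml; lra.
set x := (X in `|X|) in IH.
have xle : 0 < `|x| <= ln 2.
  rewrite normr_gt0 ln_combo_neq0 //= (le_trans IH) //.
  apply: ler_piMr; first exact: ltW.
  by rewrite invf_le1 ?exprn_gt0 // exprn_ege1 // ler1n.
have [j' [t [j'0 h]]] := @halving R x (ln 2) xle.
exists (j' * j)%N, (j'%:Z * i + t); split; first by rewrite muln_gt0 j'0.
apply: le_trans (_ : `|x| / 2 <= _).
  apply: le_trans h; rewrite le_eqVlt; apply/orP; left; apply/eqP; congr (`|_|).
  by rewrite /x natrM intrD intrM; ring.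
by rewrite exprSr invfM mulrA ler_wpM2r // invr_ge0.
Qed.

(** A bounded number of steps of length [x] climbs from 0 or, when [x] is
    negative, descends from [b], and lands just above [t]. *)
Lemma grid (R : realType) (x b t : R) : x != 0 -> 0 <= t <= b ->
  exists (l : nat) (o : bool), (l <= (Num.truncn (b / `|x|)).+1)%N /\
    t <= l%:R * x + o%:R * b <= t + `|x|.
Proof.
move=> x0 /andP[t0 tb]; have ax : 0 < `|x| by rewrite normr_gt0.
have trunc (D : R) : 0 <= D <= b ->
      (Num.truncn (D / `|x|) <= Num.truncn (b / `|x|))%N /\
      (Num.truncn (D / `|x|))%:R * `|x| <= D
        < (Num.truncn (D / `|x|))%:R * `|x| + `|x|.
  move=> /andP[D0 Db]; set l := Num.truncn (D / `|x|).
  split; first by apply: le_truncn; rewrite ler_pM2r ?invr_gt0.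
  have /andP[l1 l2] : l%:R <= D / `|x| < l.+1%:R by apply: truncn_itv; rewrite divr_ge0 // ltW.
  rewrite -ler_pdivlMr // l1 /= -[X in _ + X]mul1r -mulrDl natr1.
  by rewrite -ltr_pdivrMr.
case: (ltrgtP x 0) x0 => // xs _.
- have /trunc[lb /andP[l1 l2]] : 0 <= b - t <= b by lra.
  set l := Num.truncn _ in lb l1 l2.
  exists l, true; split; first exact: leqW.
  by rewrite ltr0_norm // in l1 l2 *; rewrite /= mul1r; lra.
- have /trunc[lb /andP[l1 l2]] : 0 <= t <= b by lra.
  set l := Num.truncn _ in lb l1 l2.
  exists l.+1, false; split=> //.
  by rewrite gtr0_norm // in l1 l2 *; rewrite /= mul0r addr0 -natr1; lra.
Qed.

(** The number of steps in [grid], hence the exponent of 12, stays bounded as n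
    grows, so that the power of 2 carries all but a bounded factor of n. *)
Lemma dense_sizes (R : realType) (delta : R) : 0 < delta ->
  exists C n0 : nat, (0 < C)%N /\ forall n : nat, (n0 <= n)%N ->
    exists a b : nat, [/\ (n <= 2 ^ a.+1 * 12 ^ b)%N,
      (2 ^ a.+1 * 12 ^ b)%N%:R <= (1 + delta) * n%:R & (n <= C * 2 ^ a)%N].
Proof.
move=> d0; have ln2 : 0 < ln 2 :> R by rewrite ln_gt0 // ltr1n.
have eta0 : 0 < ln (1 + delta) by rewrite ln_gt0 // ltrDl.
pose s := (Num.truncn (ln 2 / ln (1 + delta))).+1.
(* With 2 ^ s above ln 2 / ln (1 + delta), the step is at most ln (1 + delta). *)
have [j [i [j0 xs]]] := small_ln_combo R s.
set x := (X in `|X|) in xs.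
have xneq0 : x != 0 by apply: ln_combo_neq0.
have xle : `|x| <= ln (1 + delta).
  apply: le_trans xs _; rewrite ler_pdivrMr ?exprn_gt0 // mulrC -ler_pdivrMr //.
  apply: le_trans (_ : s%:R <= _); first by rewrite ltW // truncnS_gt.
  by rewrite -natrX ler_nat ltnW // ltn_expl.
pose L := (Num.truncn (ln 2 / `|x|)).+1.
exists (2 * 12 ^ (L * j))%N, (2 ^ (L * `|i| + 1))%N; split.
  by rewrite muln_gt0 expn_gt0.
move=> n n0; have npos : (0 < n)%N by apply: leq_trans n0; rewrite expn_gt0.
pose a0 := trunc_log 2 n.
have /andP[an na] : (2 ^ a0 <= n < 2 ^ a0.+1)%N by apply: trunc_log_bounds.
have a0L : (L * `|i| + 1 <= a0)%N by apply: trunc_log_max.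
have nR : 0 < n%:R :> R by rewrite ltr0n.
have lnpow (p e : nat) : (0 < p)%N -> ln (p ^ e)%N%:R = e%:R * ln p%:R :> R.
  by move=> p0; rewrite natrX lnXn ?ltr0n // mulr_natl.
have tb : 0 <= (ln n%:R - a0%:R * ln 2 : R) <= ln 2.
  rewrite subr_ge0 lerBlDl -[X in _ + X]mul1r -mulrDl natr1 -!(lnpow 2%N) //.
  by rewrite !ler_ln ?posrE ?ltr0n ?expn_gt0 // !ler_nat an ltnW.
(* Multiplying n by at most 1 + delta gives 2 ^ a0 * (12 ^ j / 2 ^ i) ^ l,
   possibly doubled. *)
have [l [u [lL /andP[h1 h2]]]] := @grid R _ _ _ xneq0 tb.
have [e eE] : exists e : int, e = a0%:Z + u - l%:Z * i by eexists.
have e0 : (0 < e)%R.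
  have : l%:Z * i <= (L * `|i|)%N.
    apply: le_trans (ler_norm _) _; rewrite normrM -!abszE /= -PoszM lez_nat.
    by rewrite leq_mul2r lL orbT.
  by rewrite eE; lia.
case: e e0 eE => // [[//|a]] _ eE.
have lnN : ln (2 ^ a.+1 * 12 ^ (l * j))%N%:R
    = l%:R * x + u%:R * ln 2 + a0%:R * ln 2 :> R.
  rewrite natrM lnM ?posrE ?ltr0n ?expn_gt0 // !lnpow // natrM.
  have -> : a.+1%:R = a0%:R + u%:R - l%:R * i%:~R :> R.
    by rewrite -[LHS]/(a.+1%:Z%:~R) eE intrB intrD intrM.
  by rewrite /x; ring.
have Npos : (0 < 2 ^ a.+1 * 12 ^ (l * j))%N by rewrite muln_gt0 !expn_gt0.
have lower : (n <= 2 ^ a.+1 * 12 ^ (l * j))%N.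
  rewrite -(ler_nat R) -ler_ln ?posrE ?ltr0n // lnN.
  by rewrite -lerBlDr.
exists a, (l * j)%N; split=> //.
  have d1 : 0 < 1 + delta by lra.
  rewrite -ler_ln ?posrE ?mulr_gt0 ?ltr0n // lnN lnM ?posrE //.
  rewrite -lerBrDr; apply: le_trans h2 _.
  by rewrite addrAC lerD2r addrC lerD2r.
apply: leq_trans lower _; rewrite expnS mulnC mulnCA mulnA leq_mul2r.
by rewrite leq_mul2l leq_exp2l // leq_mul2r lL !orbT.
Qed.

(** * The asymptotic upper bound *)

Lemma dims_lt (q : nat) (r : 'I_q -> nat) (m n : nat) (j : 'I_q.+2) (jq : (j < q)%N) :
  @dims q.+2 r m n j = r (Ordinal jq).
Proof.
rewrite /dims nth_cat size_map size_enum_ord jq.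
rewrite (nth_map (Ordinal jq)) ?size_enum_ord //; congr (r _).
by apply: val_inj; rewrite /= nth_enum_ord.
Qed.

Lemma dims_eq (q : nat) (r : 'I_q -> nat) (m n : nat) (j : 'I_q.+2) :
  j = q :> nat -> @dims q.+2 r m n j = m.
Proof. by move=> jq; rewrite /dims nth_cat size_map size_enum_ord jq ltnn subnn. Qed.

Lemma dims_gt (q : nat) (r : 'I_q -> nat) (m n : nat) (j : 'I_q.+2) :
  j = q.+1 :> nat -> @dims q.+2 r m n j = n.
Proof.
move=> jq; rewrite /dims nth_cat size_map size_enum_ord jq.
by rewrite ltnNge leqnSn subSnn.
Qed.

Lemma Lambda_le_sqrt (R : realType) (q : nat) (r : 'I_q -> nat) (m n a b : nat) :
  let N := (2 ^ a.+1 * 12 ^ b)%N in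
  (forall i, (r i <= 2 * a)%N) -> (m <= N)%N -> (n <= N)%N ->
  Lambda R (@dims q.+2 r m n) <= Num.sqrt N%:R.
Proof.
move=> N ra mN nN; have N0 : (0 < N)%N by rewrite muln_gt0 !expn_gt0.
have HN : hadamard R N.
  by apply: hadamard_mul; apply: hadamard_exp; [apply: hadamard2 | apply: hadamard12].
have CN : clifford_system R (2 * a) N by apply: clifford_system_exp.
move: N N0 HN CN mN nN => [//|N] _ HN CN mN nN.
have [||e he] := @clifford_sign_array R (2 * a) N q (@dims q.+2 r m n) HN CN.
- by move=> j jq; rewrite dims_lt.
- move=> j; rewrite leq_eqVlt => /orP[/eqP/esym jq | jq]; first by rewrite dims_eq.
  by rewrite dims_gt //; have := ltn_ord j; lia.
by apply: le_trans (Lambda_le _ _ _ e) _; apply: sign_form_norm_le.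
Qed.

Lemma sqrt_le_Lambda_dims (R : realType) (q : nat) (r : 'I_q -> nat) (m n : nat) :
  (forall i, (0 < r i)%N) -> (0 < m)%N -> (0 < n)%N ->
  Num.sqrt n%:R <= Lambda R (@dims q.+2 r m n).
Proof.
move=> r0 m0 n0; rewrite -[in leLHS](@dims_gt q r m n ord_max) //.
apply: sqrt_le_Lambda => j; have := ltn_ord j.
rewrite ltnS leq_eqVlt => /orP[/eqP jq | ]; first by rewrite dims_gt.
rewrite ltnS leq_eqVlt => /orP[/eqP jq | jq]; first by rewrite dims_eq.
by rewrite dims_lt.
Qed.

(** A strict bound on the limit superior leaves room for a constant strictly
    below it, which is what beats the additive loss later. *)
Lemma limn_esup_lt (R : realType) (f : nat -> R) (b : R) :
  (limn_esup (fun n => (f n)%:E) < b%:E)%E ->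
  exists2 c : R, c < b & \forall n \near \oo, f n <= c.
Proof.
move=> /ereal_inf_lt[_ [V VF <-]] sb.
exists (fine (ereal_sup ((fun n => (f n)%:E) @` V))); last first.
  near=> n.
  have nV : V n by near: n; exact: VF.
  have fn : ((f n)%:E <= ereal_sup ((fun n => (f n)%:E) @` V))%E.
    by apply: ereal_sup_ubound; exists n.
  case: ereal_sup sb fn => [s| |] //=.
have [n Vn] := filter_ex VF.
have : ((f n)%:E <= ereal_sup ((fun n => (f n)%:E) @` V))%E.
  by apply: ereal_sup_ubound; exists n.
by case: ereal_sup sb => [s| |] //=.
Unshelve. all: by end_near.
Qed.

(** For large n the condition c < 2 absorbs the additive constant log2 C lost
    between log2 n and the exponent [a], so each r_i is at most 2 a. *)
Lemma Lambda_asymp (R : realType) (q : nat) (r : nat -> 'I_q -> nat) (m : nat -> nat)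
    (c eps : R) :
  c < 2 -> 0 < eps ->
  (\forall n \near \oo, (\sum_(i < q) r n i)%N%:R / log2 (n%:R : R) <= c) ->
  (forall n, (2 <= n)%N -> (m n <= n)%N) ->
  \forall n \near \oo,
    Lambda R (@dims q.+2 (r n) (m n) n) <= (1 + eps) * Num.sqrt n%:R.
Proof.
move=> c2 e0 hc hm; have ln2 : 0 < ln 2 :> R by rewrite ln_gt0 // ltr1n.
have [C [n0 [C0 dense]]] := @dense_sizes R eps e0.
have : \forall n \near \oo, 2 * ln (C%:R : R) / (2 - c) <= ln n%:R.
  near=> n; rewrite -[leLHS]expRK ler_ln ?posrE ?expR_gt0 //.
    near: n; exact: nbhs_infty_ger.
  rewrite ltr0n; near: n; exact: nbhs_infty_gt.
move=> hln; near=> n.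
have n2 : (2 <= n)%N by near: n; exact: nbhs_infty_ge.
have /dense[a [b [nN Nn nC]]] : (n0 <= n)%N by near: n; exact: nbhs_infty_ge.
have nR : 0 < n%:R :> R by rewrite ltr0n; lia.
have lnn : 0 < ln n%:R :> R by rewrite ln_gt0 // ltr1n.
have ra i : (r n i <= 2 * a)%N.
  apply: (@leq_trans (\sum_(i < q) r n i)%N); first by rewrite (bigD1 i) //= leq_addr.
  rewrite -(ler_nat R).
  have : (\sum_(i < q) r n i)%N%:R / log2 (n%:R : R) <= c by near: n.
  rewrite /log2 ler_pdivrMr ?divr_gt0 // => /le_trans; apply.
  rewrite mulrA ler_pdivrMr //.
  have : 2 * ln (C%:R : R) / (2 - c) <= ln n%:R by near: n.
  rewrite ler_pdivrMr ?subr_gt0 // => h.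
  have : ln (n%:R : R) <= ln C%:R + a%:R * ln 2.
    rewrite mulr_natl -lnXn // -lnM ?posrE ?ltr0n ?exprn_gt0 //.
    rewrite ler_ln ?posrE ?mulr_gt0 ?ltr0n ?exprn_gt0 ?(ltnW n2) //.
    by move: nC; rewrite -(ler_nat R) natrM natrX.
  rewrite natrM; lra.
apply: le_trans (@Lambda_le_sqrt R q (r n) (m n) n a b ra _ nN) _.
  exact: leq_trans (hm n n2) nN.
rewrite -[1 + eps]gtr0_norm ?addr_gt0 // -sqrtr_sqr -sqrtrM ?sqr_ge0 //.
apply: ler_wsqrtr; apply: le_trans Nn _; rewrite ler_pM2r //; nra.
Unshelve. all: by end_near.
Qed.

Theorem theorem7p3 (R : realType) (k : nat) (hk : (3 <= k)%N)
    (r : nat -> 'I_k.-2 -> nat) (m : nat -> nat)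
    (hr : forall (n : nat) (i : 'I_k.-2), (2 <= n)%N -> (0 < r n i)%N)
    (hm : forall n : nat, (2 <= n)%N -> (0 < m n <= n)%N)
    (hlim : (limn_esup (fun n : nat =>
               ((\sum_(i < k.-2) r n i)%N%:R / log2 (n%:R : R))%:E)
             < 2%:E)%E) :
  exists2 o1 : nat -> R, o1 n @[n --> \oo] --> (0 : R) &
    forall n : nat, (2 <= n)%N ->
      Lambda R (dims (r n) (m n) n) = (1 + o1 n) * Num.sqrt (n%:R : R).
Proof.
case: k hk r hr hlim => [|[|q]] // _ r hr hlim.
have [c c2 hc] := @limn_esup_lt R _ 2 hlim.
exists (fun n => Lambda R (@dims q.+2 (r n) (m n) n) / Num.sqrt n%:R - 1).
  apply/cvgrPdist_le => eps e0.
  have upper := @Lambda_asymp R q r m c eps c2 e0 hc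
    (fun n n2 => proj2 (andP (hm n n2))).
  near=> n.
  have n2 : (2 <= n)%N by near: n; exact: nbhs_infty_ge.
  have s0 : 0 < Num.sqrt n%:R :> R by rewrite sqrtr_gt0 ltr0n; lia.
  have /andP[m0 _] := hm n n2.
  have lower : Num.sqrt n%:R <= Lambda R (@dims q.+2 (r n) (m n) n).
    have n1 : (0 < n)%N by exact: ltnW.
    by apply: sqrt_le_Lambda_dims => // i; apply: hr.
  have upper_n : Lambda R (@dims q.+2 (r n) (m n) n) <= (1 + eps) * Num.sqrt n%:R.
    by near: n.
  rewrite sub0r normrN ger0_norm ?subr_ge0 ?ler_pdivlMr ?mul1r //.
  by rewrite lerBlDl ler_pdivrMr.
move=> n n2; rewrite addrC subrK divfK // gt_eqF // sqrtr_gt0 ltr0n; lia.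
Unshelve. all: by end_near.
Qed.
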